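(* Let $d\ge 2$ be an integer, let $V=\{1,\dots,d\}$, and let $\Pi=(\pi_{ij})$ be a real $d\times d$ matrix such that: $\pi_{ii}=1$ for all $i\in V$; $\pi_{ij}>0$ for all $i,j\in V$; $\pi_{ij}\le \pi_{ik}\pi_{kj}$ for all $i,j,k\in V$; and there exist $i,j,k\in V$ with $\pi_{ij}<\pi_{ik}\pi_{kj}$. Then for every bipartition $(P,N)$ of $V$ and every $P$-configuration $c\in\mathbb{N}^P$ there exists a feasible tree solution $y\in\mathbb{R}^d$ (with respect to $(P,N)$) generated by a spanning tree $T$ of the bipartite digraph $G(P,N)$ with $\deg_T(P)=c$. Analogously, for every bipartition $(P,N)$ of $V$ and every $N$-configuration $b\in\mathbb{N}^N$ there exists a feasible tree solution $y\in\mathbb{R}^d$ (with respect to $(P,N)$) generated by a spanning tree $T$ of $G(P,N)$ with $\deg_T(N)=b$.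
   Context: $\mathbb{N}=\{1,2,\dots\}$. A bipartition $(P,N)$ of $V$ is an ordered pair of nonempty disjoint sets with $P\cup N=V$. $G(P,N)$ is the bipartite digraph with node set $V$ and arc set $P\times N$. A spanning tree of a digraph is a connected subgraph with the full node set and without cycles, where arc directions are ignored for connectedness and cycles. A vector $y\in\mathbb{R}^d$ is generated by a tree $T$ if $T$ is a spanning tree of $G(P,N)$ and $\pi_{ij}y_i=y_j>0$ for all arcs $(i,j)\in E(T)\subseteq P\times N$. A vector $y$ is feasible with respect to $(P,N)$ if $\pi_{ij}y_i\ge y_j>0$ for all $(i,j)\in P\times N$. If $y$ is both feasible and generated by a spanning tree $T$ of $G(P,N)$, it is called a feasible tree solution (generated by $T$) with respect to $(P,N)$. A $P$-configuration is a vector $c\in\mathbb{N}^P$ with $\sum_{i\in P}c_i=d-1$; an $N$-configuration is a vector $b\in\mathbb{N}^N$ with $\sum_{j\in N}b_j=d-1$. For a tree $T$ and a set $A$ of its nodes, $\deg_T(A)$ is the vector indexed by $A$ whose component at $i\in A$ is $\deg_T(i)$, the number of arcs of $T$ incident to $i$. *)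

(* Defs.v *)
From HB Require Import structures.
From mathcomp Require Import all_boot all_order all_algebra.
From mathcomp Require Import reals.

Set Implicit Arguments.
Unset Strict Implicit.
Unset Printing Implicit Defensive.

Import Order.TTheory GRing.Theory Num.Theory.

Local Open Scope ring_scope.

(* The field of real numbers is an arbitrary R : realType.
   A digraph with full node set V is represented by its arc set, of type
   {set V * V}; the arc (i, j) goes from i to j. *)

Section Digraphs.
Variable V : finType.
Implicit Types (A T : {set V * V}) (P N : {set V}).

Definition bipartition P N : Prop :=
  [/\ P != set0, N != set0, [disjoint P & N] & P :|: N = [set: V]].

Definition bip_digraph P N : {set V * V} := setX P N.

Definition adj T : rel V := fun i j => ((i, j) \in T) || ((j, i) \in T).

Definition dconnected T : Prop := forall i j : V, connect (adj T) i j.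

(* Directions are ignored, but arcs are counted as distinct edges: a loop and
   a pair of antiparallel arcs are cycles of length 1 and 2; they are excluded
   by the first clause, and the longer cycles by the second. *)
Definition dacyclic T : Prop :=
  (forall i j : V, (i, j) \in T -> (j, i) \notin T) /\
  (forall s : seq V, (2 < size s)%N -> ~ ucycle (adj T) s).

Definition spanning_tree A T : Prop :=
  [/\ T \subset A, dconnected T & dacyclic T].

Definition deg T (i : V) : nat := #|[set a in T | (a.1 == i) || (a.2 == i)]|.

End Digraphs.

(* A vector indexed by A is given by a function on all of 'I_d of which only
   the values on A matter; the entries lie in {1, 2, ...}. *)
Definition configuration (d : nat) (A : {set 'I_d}) (c : 'I_d -> nat) : Prop :=
  (forall i, i \in A -> (0 < c i)%N) /\ (\sum_(i in A) c i = d - 1)%N.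

Section TreeSolutions.
Variables (R : realType) (d : nat) (Pi : 'M[R]_d) (P N : {set 'I_d}).

Definition generated (T : {set 'I_d * 'I_d}) (y : 'rV[R]_d) : Prop :=
  spanning_tree (bip_digraph P N) T /\
  (forall i j, (i, j) \in T -> Pi i j * y 0 i = y 0 j /\ 0 < y 0 j).

Definition feasible (y : 'rV[R]_d) : Prop :=
  forall i j, (i, j) \in bip_digraph P N ->
    y 0 j <= Pi i j * y 0 i /\ 0 < y 0 j.

Definition feasible_tree_solution (T : {set 'I_d * 'I_d}) (y : 'rV[R]_d)
  : Prop := feasible y /\ generated T y.

End TreeSolutions.

(* Main.v *)
Require Import Defs.
From HB Require Import structures.
From mathcomp Require Import all_boot all_order all_algebra.
From mathcomp Require Import reals zify.

Set Implicit Arguments.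
Unset Strict Implicit.
Unset Printing Implicit Defensive.

Import Order.TTheory GRing.Theory Num.Theory.

Local Open Scope ring_scope.

(** Taking logarithms, a feasible tree solution is a dual solution of a
    transportation problem from P to N with costs log Pi, together with a
    spanning tree of tight arcs; such trees are optimal bases.  The degrees are
    controlled by the supplies and demands.  Let A be the side (P or N) on which
    the degrees c are prescribed, and p = #|A|.  Give every node v of A the load
    p (c v - 1) + 1 and every other node the load p.

    - Total loads on both sides agree, and counting modulo p shows that they
      agree on no proper nonempty subset of V.  So the arcs carrying a positive
      flow always connect V.
    - Among the integral flows, of which there are finitely many, take one of
      least cost, and among those one whose sum of squares is largest.  A cycle
      in its support could be pushed in both directions without changing the
      cost, and one of the two pushes would increase the sum of squares.  So the
      support T is a spanning tree ([optimal_support_acyclic]).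
    - Optimality says that no cycle of the residual graph has negative cost, so
      shortest path lengths from a fixed node are potentials
      ([potential_of_cycle_weight_ge1]): they are feasible, and tight on T.
    - An arc carries at most p units, so a node v of A with load p (c v - 1) + 1
      meets at least c v arcs of T.  These lower bounds add up to d - 1, which is
      the largest number of arcs of a forest ([dacyclic_card]), so they are all
      equalities.

    Costs are kept multiplicative, as products of powers of the entries of Pi,
    which avoids logarithms. *)

(** * Forests *)

Section Forests.
Variable V : finType.
Implicit Types (T : {set V * V}) (a b u v : V).

Lemma adj_sym T : symmetric (adj T).
Proof. by move=> u v; rewrite /adj orbC. Qed.

Lemma adjS T T' : T \subset T' -> subrel (adj T) (adj T').
Proof.
by move=> /subsetP sTT' u v /orP[]/sTT' uvT'; apply/orP; [left | right].
Qed.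

(** A path joining the ends of a removed arc would close up to a cycle with it;
    the length-two case is the antiparallel pair excluded separately. *)
Lemma dacyclic_bridge T a b : dacyclic T -> (a, b) \in T ->
  ~~ connect (adj (T :\ (a, b))) a b.
Proof.
move=> [no2 nocyc] abT; apply/negP => /connectP[p].
case/shortenP=> q abq Uq _ def_b.
have sT : subrel (adj (T :\ (a, b))) (adj T) by apply: adjS; apply: subsetDl.
case: q abq Uq def_b => [|u [|v q]] abq Uq def_b.
- by have := no2 a b abT; rewrite def_b /= in abT *; rewrite abT.
- move: abq; rewrite /= in def_b *; rewrite -def_b andbT /adj !inE eqxx /=.
  by case/andP=> _ baT; have := no2 a b abT; rewrite baT.
- apply: (nocyc [:: a, u, v & q]) => //; apply/andP; split=> //.
  rewrite /cycle rcons_path (sub_path sT abq) -def_b.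
  by rewrite /adj abT orbT.
Qed.

(** The incidence matrix of a forest has independent rows: removing an arc
    splits off a component, and the indicator functions of these components
    form a right inverse of the matrix.  Since the rows also annihilate the
    constants, there are fewer rows than columns. *)
Lemma dacyclic_card T : (0 < #|V|)%N -> dacyclic T -> (#|T| < #|V|)%N.
Proof.
move=> V_gt0 acT.
pose e (k : 'I_#|T|) : V * V := enum_val k.
pose cut (k : 'I_#|T|) v := connect (adj (T :\ e k)) (e k).1 v.
pose inc : 'M[rat]_(#|T|, #|V|) :=
  \matrix_(k, m) ((enum_val m == (e k).1)%:R - (enum_val m == (e k).2)%:R).
have incE k (f : V -> rat) :
    \sum_m inc k m * f (enum_val m) = f (e k).1 - f (e k).2.
  under eq_bigr do rewrite mxE.
  rewrite -(big_enum_val (fun v => ((v == (e k).1)%:R - (v == (e k).2)%:R) * f v)) /=.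
  have pick u : \sum_v (v == u)%:R * f v = f u.
    rewrite (bigD1 u) //= eqxx mul1r big1 ?addr0 // => v /negbTE->.
    by rewrite mul0r.
  by under eq_bigr do rewrite mulrBl; rewrite sumrB !pick.
pose B : 'M[rat]_(#|V|, #|T|) := \matrix_(m, k) (cut k (enum_val m))%:R.
have incB : inc *m B = 1%:M.
  apply/matrixP=> k l; rewrite !mxE.
  under eq_bigr do rewrite [B _ _]mxE.
  rewrite (incE k (fun v => (cut l v)%:R)).
  have ekT : e k \in T by apply: enum_valP.
  case: eqVneq => [<- | kl]; last first.
    suff -> : cut l (e k).1 = cut l (e k).2 by rewrite subrr.
    have kT' : adj (T :\ e l) (e k).1 (e k).2.
      by rewrite /adj -surjective_pairing !inE ekT (inj_eq enum_val_inj) kl.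
    by apply: same_connect_r; [apply/sym_connect_sym/adj_sym | apply: connect1].
  rewrite {1}/cut connect0 [cut _ _](negbTE _) ?subr0 //.
  rewrite /cut [X in T :\ X]surjective_pairing.
  by apply: dacyclic_bridge; rewrite -?surjective_pairing.
have rk_inc : \rank inc = #|T| by apply/eqP/row_freeP; exists B.
have inc1 : inc *m (const_mx 1 : 'cV_#|V|) = 0.
  apply/matrixP=> k l; rewrite !mxE.
  under eq_bigr do rewrite [const_mx _ _ _]mxE.
  by rewrite (incE k (fun=> 1)) subrr.
have := mulmx0_rank_max inc1; rewrite rk_inc => le_V.
apply: leq_trans le_V; rewrite -[X in (X < _)%N]addn0 ltn_add2l lt0n mxrank_eq0.
apply/eqP => /matrixP/(_ (Ordinal V_gt0) ord0); rewrite !mxE => /eqP.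
by rewrite oner_eq0.
Qed.

End Forests.

(** * Potentials *)

Section Potentials.
Variables (R : realFieldType) (V : finType) (e : rel V) (g : V -> V -> R).
Implicit Types (u v : V) (s : seq V).

Fixpoint path_weight u s : R :=
  if s is v :: s' then g u v * path_weight v s' else 1.

Definition cycle_weight s : R := \prod_(v <- s) g v (next s v).

Lemma path_weight_cat u s s' :
  path_weight u (s ++ s') = path_weight u s * path_weight (last u s) s'.
Proof. by elim: s u => [|v s IHs] u /=; rewrite ?mul1r // IHs mulrA. Qed.

(** Generalizes [cycle_weight_cons] by separating the closing node [z] from
    the starting node, which is what the induction needs. *)
Lemma next_at_weight z u s : uniq (u :: s) ->
  \prod_(v <- u :: s) g v (next_at v z u s) = path_weight u (rcons s z).
Proof.
elim: s u => [|w s IHs] u; first by rewrite big_seq1 /= eqxx mulr1.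
rewrite cons_uniq => /andP[uws Us].
rewrite big_cons /= eqxx -(IHs _ Us); congr (_ * _).
apply: eq_big_seq => v vws.
by rewrite [v == u]negbTE //; apply: contraNneq uws => <-.
Qed.

Lemma cycle_weight_cons u s : uniq (u :: s) ->
  cycle_weight (u :: s) = path_weight u (rcons s u).
Proof. exact: next_at_weight. Qed.

Hypothesis g_gt0 : forall u v, 0 < g u v.
Hypothesis cycle_weight_ge1 :
  forall s, ucycle e s -> s != [::] -> 1 <= cycle_weight s.

Lemma path_weight_gt0 u s : 0 < path_weight u s.
Proof. by elim: s u => [|v s IHs] u //=; rewrite mulr_gt0. Qed.

(** The potential of v is the least weight of a simple path from r to v.  If
    appending the step from u to v to a shortest path to u revisits v, then the
    part from v onwards is a cycle of weight at least 1, and dropping it gives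
    a path to v that is no heavier. *)
Lemma potential_of_cycle_weight_ge1 r : (forall v, connect e r v) ->
  exists y : V -> R, (forall v, 0 < y v) /\
    (forall u v, e u v -> y v <= y u * g u v).
Proof.
move=> conn.
pose from_r v s := [&& path e r s, uniq (r :: s) & last r s == v].
have shortest v : exists s, from_r v s /\
    (forall s', from_r v s' -> path_weight r s <= path_weight r s').
  have bound s : from_r v s -> (size s <= #|V|)%N.
    case/and3P=> _ Us _; have := max_card (mem (r :: s)).
    by rewrite (card_uniqP Us); apply: ltnW.
  have [s0 s0v] : exists s, from_r v s.
    have /connectP[p rp ->] := conn v.
    by case/shortenP: rp => s rs Us _; exists s; rewrite /from_r rs Us eqxx.
  have [s sv s_min] := @Order.TotalTheory.arg_minP _ _ _
    (Bseq (bound s0 s0v)) (fun s : #|V|.-bseq V => from_r v s)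
    (fun s : #|V|.-bseq V => path_weight r s) s0v.
  by exists (val s); split=> // s' s'v; have := s_min (Bseq (bound s' s'v)) s'v.
have [p p_spec] := fin_all_exists shortest.
exists (fun v => path_weight r (p v)).
split=> [v | u v euv]; first exact: path_weight_gt0.
have [/and3P[ru Uu /eqP lu] _] := p_spec u.
have [_ v_min] := p_spec v.
(* Either the extended path is still simple, or it closes a cycle at v. *)
have [v_on | v_off] := boolP (v \in r :: p u); last first.
  have := v_min (rcons (p u) v); rewrite -cats1 path_weight_cat /= mulr1 lu.
  apply; rewrite /from_r cats1 rcons_path ru lu euv last_rcons eqxx andbT.
  by rewrite -rcons_cons rcons_uniq v_off Uu.
move: ru Uu lu; case/splitPl: v_on => s1 s2 ls1.
rewrite cat_path last_cat ls1 => /andP[rs1 vs2].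
rewrite -cat_cons cat_uniq => /and3P[Us1 /hasPn s12 Us2] lu.
rewrite path_weight_cat ls1 -mulrA.
have s1v : from_r v s1 by rewrite /from_r rs1 Us1 ls1 eqxx.
apply: le_trans (v_min _ s1v) _; rewrite ler_peMr ?(ltW (path_weight_gt0 _ _)) //.
have Uvs2 : uniq (v :: s2).
  rewrite /= Us2 andbT; apply/negP => /s12.
  by rewrite /= -ls1 mem_last.
have := @cycle_weight_ge1 (v :: s2); rewrite cycle_weight_cons //.
rewrite -cats1 path_weight_cat /= mulr1 lu; apply=> //.
by rewrite /ucycle Uvs2 /cycle rcons_path vs2 lu euv.
Qed.

End Potentials.

(** * Integral flows *)

Section Flows.
Variables (V : finType) (P : {set V}).
Implicit Types (u v : V) (a : V * V) (x : V * V -> nat) (c : seq V).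

Local Notation arcs := (bip_digraph P (~: P)).

(** For a flow supported on the arcs from P to its complement this is the
    outflow at a node of P and the inflow at any other node, so one formula
    expresses both the supply and the demand constraints. *)
Definition margin x v : nat := (\sum_(a | (a.1 == v) || (a.2 == v)) x a)%N.

Definition flow (s : V -> nat) x : Prop :=
  (forall a, a \notin arcs -> x a = 0%N) /\ (forall v, margin x v = s v).

Definition flow_arcs x : {set V * V} := [set a | (0 < x a)%N].

Lemma mem_arcs u v : ((u, v) \in arcs) = (u \in P) && (v \notin P).
Proof. by rewrite in_setX inE. Qed.

Lemma flow_arcs_sub s x : flow s x -> flow_arcs x \subset arcs.
Proof.
case=> x0 _; apply/subsetP=> a; rewrite inE.
by apply: contraTT => /x0->.
Qed.

Lemma flow_le s x a v : flow s x -> (a.1 == v) || (a.2 == v) -> (x a <= s v)%N.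
Proof. by case=> _ <- av; rewrite /margin (bigD1 a) //= leq_addr. Qed.

Lemma eq_margin x x' : x =1 x' -> margin x =1 margin x'.
Proof. by move=> eqx v; apply: eq_bigr => a _. Qed.

Lemma margin_pred1 b v :
  margin (fun a => (a == b) : nat) v = ((b.1 == v) || (b.2 == v)).
Proof.
rewrite /margin; have [bv|bv] := boolP (_ || _); last first.
  by rewrite big1 // => a av; case: (a =P b) av => // ->; rewrite (negbTE bv).
by rewrite (bigD1 b) //= eqxx big1 // => a /andP[_ /negbTE->].
Qed.

(** Greedily: while some load is positive, send one unit between two loaded
    nodes on opposite sides. *)
Lemma flow_exists s : (\sum_(v in P) s v = \sum_(v in ~: P) s v)%N ->
  exists x, flow s x.
Proof.
have [n] := ubnP (\sum_(v in P) s v)%N.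
elim: n s => // n IHn s; rewrite ltnS => le_n bal.
have [s0|] := boolP [forall (v | v \in P), s v == 0%N].
  have sP v : v \in P -> s v = 0%N by move=> vP; apply/eqP/(forall_inP s0).
  have /forall_inP sN : [forall (v | v \in ~: P), s v == 0%N].
    by rewrite -sum_nat_eq0 -bal big1.
  exists (fun=> 0%N); split=> // v; rewrite /margin big1 //.
  have [/sP//|vP] := boolP (v \in P).
  by apply/esym/eqP/sN; rewrite inE.
rewrite negb_forall_in => /exists_inP[i iP si].
have : (0 < \sum_(v in ~: P) s v)%N by rewrite -bal (bigD1 i) //= addn_gt0 lt0n si.
rewrite lt0n sum_nat_eq0 negb_forall_in => /exists_inP[j jN sj].
pose d v : nat := (v == i) || (v == j).
have ds v : (d v <= s v)%N.
  by rewrite /d; case: eqP => [->|_]; last case: eqP => [->|]; rewrite //= lt0n.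
have dP : (\sum_(v in P) d v = 1)%N.
  rewrite (bigD1 i) //= /d eqxx big1 // => v /andP[vP /negbTE->] /=.
  by case: eqP vP => // ->; rewrite inE in jN; rewrite (negbTE jN).
have dN : (\sum_(v in ~: P) d v = 1)%N.
  rewrite (bigD1 j) //= /d eqxx orbT big1 // => v /andP[vN /negbTE->] /=.
  by case: eqP vN => // ->; rewrite inE iP.
have sumD (A : {set V}) :
    (\sum_(v in A) (s v - d v) + \sum_(v in A) d v = \sum_(v in A) s v)%N.
  by rewrite -big_split; apply: eq_bigr => v _ /=; rewrite subnK.
have [||x [x0 xm]] := IHn (fun v => s v - d v)%N.
- by move: le_n; rewrite -sumD dP addn1.
- by apply/eqP; rewrite -(eqn_add2r 1) -{1}dP -dN !sumD bal.
exists (fun a => x a + (a == (i, j)))%N; split=> [a aP | v].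
  rewrite x0 // add0n; case: eqP aP => // ->.
  by rewrite mem_arcs iP -in_setC jN.
rewrite /margin big_split /= -!/(margin _ _) xm margin_pred1 /=.
by rewrite (eq_sym i) (eq_sym j) subnK.
Qed.

(** One unit on each arc that the cycle traverses forwards.  The arcs that it
    traverses backwards are the forward arcs of [rev c], so pushing a unit along
    [c] adds [cycle_flow c] and subtracts [cycle_flow (rev c)]. *)
Definition cycle_flow c a : nat :=
  [&& a \in arcs, a.1 \in c & next c a.1 == a.2].

Definition crossing u v := (u \in P) != (v \in P).

Lemma next_crossing c v : ucycle crossing c -> v \in c ->
  (next c v \in P) = (v \notin P).
Proof.
case/andP=> cyc _ vc; have := next_cycle cyc vc.
by rewrite /crossing; do 2!case: (_ \in P).
Qed.

Lemma ucycle_rev_crossing c : ucycle crossing c -> ucycle crossing (rev c).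
Proof.
rewrite /ucycle rev_uniq rev_cycle => /andP[cyc ->]; rewrite andbT.
by rewrite -(eq_cycle (e := crossing)) // => u v; rewrite /crossing eq_sym.
Qed.

(** Because the cycle alternates between the two sides, a node of P on it has
    its outgoing arc as the only forward arc, any other node its incoming one. *)
Lemma margin_cycle_flow c v : ucycle crossing c ->
  margin (cycle_flow c) v = (v \in c).
Proof.
move=> cyc; have Uc : uniq c by case/andP: cyc.
have [vc|vc] := boolP (v \in c); last first.
  rewrite /margin big1 // => -[a b] /= ab; rewrite /cycle_flow /=.
  case: and3P => // -[_ ac /eqP nab].
  by case/orP: ab vc => /eqP <-; rewrite -?nab ?mem_next ac.
have [vP|vP] := boolP (v \in P).
  rewrite -[RHS](_ : margin (fun a => (a == (v, next c v)) : nat) v = 1%N);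
    last by rewrite margin_pred1 eqxx.
  apply: eq_bigr => -[a b] /= ab; rewrite /cycle_flow mem_arcs xpair_eqE /=.
  congr (nat_of_bool _); have [av | av] /= := eqVneq a v.
    rewrite {a ab}av vP vc /= eq_sym; case: eqP => [->|]; last by rewrite andbF.
    by rewrite next_crossing ?vP.
  case/orP: ab => /eqP; first by move/eqP; rewrite (negbTE av).
  by move=> ->; rewrite vP andbF.
rewrite -[RHS](_ : margin (fun a => (a == (prev c v, v)) : nat) v = 1%N);
  last by rewrite margin_pred1 eqxx orbT.
apply: eq_bigr => -[a b] /= ab; rewrite /cycle_flow mem_arcs xpair_eqE /=.
congr (nat_of_bool _); have [bv | bv] /= := eqVneq b v; last first.
  rewrite andbF; case/orP: ab => /eqP.
    by move=> ->; rewrite (negbTE vP).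
  by move/eqP; rewrite (negbTE bv).
rewrite {b ab}bv vP !andbT.
apply/and3P/eqP => [[_ _ /eqP <-] | ->]; first by rewrite prev_next.
have pc : prev c v \in c by rewrite mem_prev.
rewrite pc next_prev ?eqxx //; split=> //.
by have := next_crossing cyc pc; rewrite next_prev // (negbTE vP) => /esym/negbFE.
Qed.

(** The moves allowed at x: increase any arc, decrease any arc with positive
    flow. *)
Definition residual x u v := ((u, v) \in arcs) || (0 < x (v, u))%N.

Lemma residual_crossing s x : flow s x -> subrel (residual x) crossing.
Proof.
move=> fx u v /orP[|xvu]; rewrite /crossing.
  by rewrite mem_arcs => /andP[-> /negbTE->].
have : (v, u) \in arcs by apply: (subsetP (flow_arcs_sub fx)); rewrite inE.
by rewrite mem_arcs => /andP[-> /negbTE->].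
Qed.

(** The margins of [cycle_flow c] and [cycle_flow (rev c)] are equal, and a
    backwards arc carries at least the unit that is subtracted.  The conclusion
    is an addition so that no truncated subtraction leaks out. *)
Lemma flow_push s x c : flow s x -> ucycle (residual x) c ->
  exists2 x', flow s x' &
    forall a, (x' a + cycle_flow (rev c) a = x a + cycle_flow c a)%N.
Proof.
move=> fx cycr; have cyc : ucycle crossing c.
  case/andP: cycr => + U; rewrite /ucycle U andbT.
  exact: (sub_cycle (residual_crossing fx)).
have [x0 xm] := fx.
have le_rev a : (cycle_flow (rev c) a <= x a + cycle_flow c a)%N.
  case: a => u v; rewrite {1}/cycle_flow mem_rev /=.
  case: and3P => //= -[uvP uc]; case/andP: cycr => cycr Uc.
  rewrite next_rev // => /eqP puv; rewrite addn_gt0.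
  have := prev_cycle cycr uc; rewrite puv /residual => /orP[|-> //].
  by move: uvP; rewrite !mem_arcs => /andP[-> _]; rewrite andbF.
exists (fun a => x a + cycle_flow c a - cycle_flow (rev c) a)%N; last first.
  by move=> a; rewrite subnK.
split=> [a aP | v].
  by rewrite x0 // /cycle_flow (negbTE aP).
rewrite /margin sumnB // big_split /= -!/(margin _ _) xm.
rewrite (margin_cycle_flow v cyc) (margin_cycle_flow v (ucycle_rev_crossing cyc)).
by rewrite mem_rev addnK.
Qed.

End Flows.

(** * Optimal flows *)

Section OptimalFlows.
Variables (R : realFieldType) (V : finType) (P : {set V}) (w : V * V -> R).
Hypothesis w_gt0 : forall a, 0 < w a.
Implicit Types (s : V -> nat) (u v : V) (a : V * V) (x : V * V -> nat) (c : seq V).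

Local Notation arcs := (bip_digraph P (~: P)).

Definition cost x : R := \prod_a w a ^+ x a.

Definition energy x : nat := (\sum_a x a ^ 2)%N.

(** The secondary criterion is strictly convex, so maximizing it among the
    flows of least cost forces an extreme one, whose support has no cycle. *)
Definition optimal s x : Prop :=
  [/\ flow P s x, forall x', flow P s x' -> cost x <= cost x' &
      forall x', flow P s x' -> cost x' = cost x -> (energy x' <= energy x)%N].

Lemma cost_gt0 x : 0 < cost x.
Proof. by apply: prodr_gt0 => a _; rewrite exprn_gt0. Qed.

Lemma eq_cost x x' : x =1 x' -> cost x = cost x'.
Proof. by move=> eqx; apply: eq_bigr => a _; rewrite eqx. Qed.

Lemma eq_energy x x' : x =1 x' -> energy x = energy x'.
Proof. by move=> eqx; apply: eq_bigr => a _; rewrite eqx. Qed.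

Lemma costD x x' : cost (fun a => x a + x' a)%N = cost x * cost x'.
Proof. by rewrite /cost -big_split; apply: eq_bigr => a _; rewrite exprD. Qed.

(** Flows are bounded by the total load M, hence form a finite set. *)
Lemma optimal_exists s x0 : flow P s x0 -> exists x, optimal s x.
Proof.
pose M := (\sum_v s v)%N.
pose dec (f : {ffun V * V -> 'I_M.+1}) a : nat := f a.
pose is_flow (f : {ffun V * V -> 'I_M.+1}) :=
  [forall a, (a \notin arcs) ==> (dec f a == 0%N)] &&
  [forall v, margin (dec f) v == s v].
have is_flowP (f : {ffun V * V -> 'I_M.+1}) : reflect (flow P s (dec f)) (is_flow f).
  apply: (iffP andP) => -[f0 fm]; split.
  - by move=> a aP; apply/eqP/(implyP (forallP f0 a)).
  - by move=> v; apply/eqP/(forallP fm).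
  - by apply/forallP=> a; apply/implyP=> /f0->.
  - by apply/forallP=> v; apply/eqP/fm.
pose enc x : {ffun V * V -> 'I_M.+1} := [ffun a => inord (x a)].
have encE x : flow P s x -> x =1 dec (enc x).
  move=> fx a; rewrite /dec ffunE inordK // ltnS.
  apply: (@leq_trans (s a.1)); first by apply: (flow_le fx); rewrite eqxx.
  by rewrite /M (bigD1 a.1) //= leq_addr.
have enc_flow x : flow P s x -> is_flow (enc x).
  move=> fx; apply/is_flowP; case: (fx) => x0' xm.
  by split=> [a /x0' | v]; rewrite -?(eq_margin (encE x fx)) -?encE.
move=> fx0.
have [f f_flow f_min] := @Order.TotalTheory.arg_minP _ _ _ (enc x0) is_flow
  (cost \o dec) (enc_flow _ fx0).
pose is_opt (h : {ffun V * V -> 'I_M.+1}) :=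
  is_flow h && (cost (dec h) == cost (dec f)).
have f_opt : is_opt f by rewrite /is_opt f_flow eqxx.
have [h /andP[h_flow /eqP h_cost] h_max] :=
  @arg_maxnP _ f is_opt (energy \o dec) f_opt.
exists (dec h); split=> [|x fx|x fx x_cost]; first exact/is_flowP.
  by rewrite h_cost (eq_cost (encE x fx)); apply/f_min/enc_flow.
rewrite (eq_energy (encE x fx)); apply: h_max.
by rewrite /is_opt enc_flow //= -(eq_cost (encE x fx)) x_cost h_cost.
Qed.

Definition residual_weight u v : R :=
  if u \in P then w (u, v) else (w (v, u))^-1.

Lemma residual_weight_gt0 u v : 0 < residual_weight u v.
Proof. by rewrite /residual_weight; case: ifP; rewrite ?invr_gt0. Qed.

Lemma cost_cycle_flow c : ucycle (crossing P) c ->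
  cost (cycle_flow P c) = \prod_(u | (u \in c) && (u \in P)) w (u, next c u).
Proof.
move=> cyc.
transitivity (\prod_u \prod_v w (u, v) ^+ cycle_flow P c (u, v)).
  by rewrite pair_bigA; apply: eq_bigr => -[].
rewrite [RHS]big_mkcond; apply: eq_bigr => u _.
rewrite (bigD1 (next c u)) //= big1 ?mulr1 => [|v vn]; last first.
  by rewrite /cycle_flow /= [_ == v]eq_sym (negbTE vn) !andbF.
rewrite /cycle_flow mem_arcs eqxx /= andbT.
have [uc|uc] := boolP (u \in c); last by rewrite andbF.
by rewrite next_crossing // negbK andbb andbT; case: (u \in P).
Qed.

Lemma cost_cycle_flow_rev c : ucycle (crossing P) c ->
  cost (cycle_flow P (rev c)) =
    \prod_(u | (u \in c) && (u \notin P)) w (next c u, u).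
Proof.
move=> cyc; have Uc : uniq c by case/andP: cyc.
rewrite cost_cycle_flow; last exact: ucycle_rev_crossing.
rewrite (reindex_inj (can_inj (prev_next Uc))) /=.
apply: eq_big => [u | u _]; last by rewrite next_rev // prev_next.
rewrite mem_rev mem_next; have [uc|//] := boolP (u \in c).
by rewrite next_crossing.
Qed.

(** The weight of a cycle in the residual graph is the factor by which the
    cost of a flow changes when a unit is pushed along it. *)
Lemma cycle_weight_cost c : ucycle (crossing P) c ->
  cycle_weight residual_weight c * cost (cycle_flow P (rev c)) =
    cost (cycle_flow P c).
Proof.
move=> cyc; have Uc : uniq c by case/andP: cyc.
rewrite cost_cycle_flow_rev // cost_cycle_flow // /cycle_weight big_uniq //=.
rewrite (bigID (mem P)) /= -mulrA -big_split /= [X in _ * X]big1 ?mulr1.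
  by apply: eq_bigr => u /andP[_ uP]; rewrite /residual_weight uP.
move=> u /andP[_ /negbTE uP].
by rewrite /residual_weight uP mulVf // gt_eqF.
Qed.

Lemma optimal_cycle_weight_ge1 s x c : optimal s x ->
  ucycle (residual P x) c -> 1 <= cycle_weight residual_weight c.
Proof.
case=> fx x_min _ cycr.
have [x' fx' x'E] := flow_push fx cycr.
have cyc : ucycle (crossing P) c.
  case/andP: cycr => + U; rewrite /ucycle U andbT.
  exact: (sub_cycle (residual_crossing fx)).
have : cost x' * cost (cycle_flow P (rev c)) = cost x * cost (cycle_flow P c).
  by rewrite -!costD; apply: eq_cost.
rewrite -(cycle_weight_cost cyc) mulrA => /(mulIf (lt0r_neq0 (cost_gt0 _))) x'x.
by rewrite -(ler_pM2l (cost_gt0 x)) mulr1 -x'x x_min.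
Qed.

Lemma ucycle_rev_adj T c : ucycle (adj T) (rev c) = ucycle (adj T) c.
Proof.
rewrite /ucycle rev_uniq rev_cycle; congr (_ && _).
by apply: eq_cycle => u v; rewrite adj_sym.
Qed.

(** A cycle of length two traverses the same arc in both directions and pushes
    nothing; a longer one never does. *)
Lemma cycle_flow_rev_neq c : ucycle (crossing P) c -> (2 < size c)%N ->
  exists a, cycle_flow P c a != cycle_flow P (rev c) a.
Proof.
move=> cyc c_gt2; have Uc : uniq c by case/andP: cyc.
have [v vc vP] : exists2 v, v \in c & v \in P.
  case: c c_gt2 cyc {Uc} => // v c _ cyc.
  have [vP|vP] := boolP (v \in P); first by exists v; rewrite ?mem_head.
  exists (next (v :: c) v); first by rewrite mem_next mem_head.
  by rewrite next_crossing ?mem_head.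
exists (v, next c v); rewrite /cycle_flow mem_arcs next_rev //= mem_rev vc.
rewrite next_crossing // vP eqxx /=.
suff /negbTE-> : prev c v != next c v by [].
apply/eqP; move: c_gt2 Uc.
case/rot_to: vc => i [|v1 [|v2 c']] rc.
- by rewrite -(size_rot i) rc.
- by rewrite -(size_rot i) rc.
move=> _ Uc; rewrite -(next_rot i) // => n_eq.
have {n_eq} := f_equal (next (rot i c)) n_eq.
rewrite -(prev_rot i Uc) next_prev ?rot_uniq // rc.
have := Uc; rewrite -(rot_uniq i) rc /= !inE !negb_or eq_sym eqxx.
by case/andP=> /and3P[/negbTE-> /negbTE v2v _] _ /eqP; rewrite eqxx v2v.
Qed.

(** Around a cycle of the support a unit can be pushed both ways.  The two
    changes of cost are inverse to each other, so by optimality neither changes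
    the cost; but the squares of the two new flows add up to more than twice
    those of the old one. *)
Lemma optimal_support_acyclic s x : optimal s x -> dacyclic (flow_arcs x).
Proof.
case=> fx x_min x_max; split.
  move=> u v uv; apply: contraTN uv => /(subsetP (flow_arcs_sub fx)).
  rewrite mem_arcs => /andP[_ uP]; apply/negP=> /(subsetP (flow_arcs_sub fx)).
  by rewrite mem_arcs (negbTE uP).
move=> c c_gt2 cyc.
have adj_res c' : ucycle (adj (flow_arcs x)) c' -> ucycle (residual P x) c'.
  case/andP=> + U; rewrite /ucycle U andbT; apply: sub_cycle => u v.
  case/orP=> [/(subsetP (flow_arcs_sub fx)) uv | ]; rewrite /residual ?uv //.
  by rewrite inE => ->; rewrite orbT.
have [x1 fx1 x1E] := flow_push fx (adj_res _ cyc).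
have := cyc; rewrite -ucycle_rev_adj => /adj_res/(flow_push fx)[x2 fx2].
rewrite revK => x2E.
have c1 : cost x1 * cost (cycle_flow P (rev c)) = cost x * cost (cycle_flow P c).
  by rewrite -!costD; apply: eq_cost.
have c2 : cost x2 * cost (cycle_flow P c) = cost x * cost (cycle_flow P (rev c)).
  by rewrite -!costD; apply: eq_cost.
have cE : cost (cycle_flow P c) = cost (cycle_flow P (rev c)).
  apply/le_anti/andP; split; rewrite -(ler_pM2l (cost_gt0 x)).
    by rewrite -c2 ler_pM2r ?cost_gt0 // x_min.
  by rewrite -c1 ler_pM2r ?cost_gt0 // x_min.
have nz := lt0r_neq0 (cost_gt0 (cycle_flow P (rev c))).
move: c1 c2; rewrite cE.
move=> /(mulIf nz) /(x_max _ fx1) e1 /(mulIf nz) /(x_max _ fx2) e2.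
have [b b_ne] : exists b, cycle_flow P c b != cycle_flow P (rev c) b.
  apply: cycle_flow_rev_neq => //.
  case/andP: (adj_res _ cyc) => + U; rewrite /ucycle U andbT.
  exact: (sub_cycle (residual_crossing fx)).
(* (x + e)^2 + (x - e)^2 exceeds 2 x^2 by 2 e^2, and e is nonzero at b. *)
suff : (energy x + energy x < energy x1 + energy x2)%N.
  by rewrite ltnNge leq_add.
rewrite /energy -!big_split /=.
have sq a : (x a ^ 2 + x a ^ 2 + (cycle_flow P c a != cycle_flow P (rev c) a)
    <= x1 a ^ 2 + x2 a ^ 2)%N.
  have := x1E a; have := x2E a.
  have : (cycle_flow P c a <= 1)%N by rewrite /cycle_flow leq_b1.
  have : (cycle_flow P (rev c) a <= 1)%N by rewrite /cycle_flow leq_b1.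
  case: (cycle_flow P c a) => [|[|?]] //;
  case: (cycle_flow P (rev c) a) => [|[|?]] // _ _;
  rewrite !addn0 ?addn1 /=.
  - by move=> -> ->.
  - by move=> -> <-; nia.
  - by move=> <- ->; nia.
  - by move=> [->] [->].
rewrite [X in (X < _)%N](bigD1 b) //= [X in (_ < X)%N](bigD1 b) //=.
rewrite -addSn leq_add //; first by have := sq b; rewrite b_ne addn1.
by apply: leq_sum => a _; apply: leq_trans (sq a); rewrite leq_addr.
Qed.

End OptimalFlows.

(** * Nondegenerate transportation problems *)

Section Transportation.
Variables (V : finType) (P : {set V}).
Implicit Types (s : V -> nat) (C : {set V}) (x : V * V -> nat).

Local Notation arcs := (bip_digraph P (~: P)).

(** Each arc has exactly one end in P and one outside, so node sums over one
    side turn into arc sums. *)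
Lemma sum_flow_out s x C : flow P s x ->
  (\sum_(v in C :&: P) s v = \sum_(a | a.1 \in C) x a)%N.
Proof.
case=> x0 xm; rewrite (bigID (fun a => a.1 \in P)) /= addnC.
rewrite [X in (X + _)%N]big1 ?add0n; last first.
  by move=> [u v] /= /andP[_ uP]; apply: x0; rewrite mem_arcs (negbTE uP).
rewrite (partition_big (fun a => a.1) (fun v => v \in C :&: P)) /=; last first.
  by move=> a; rewrite inE.
apply: eq_bigr => v vCP; rewrite -xm /margin (bigID (fun a => a.1 == v)) /=.
rewrite [X in (_ + X)%N]big1 ?addn0.
  apply: eq_bigl => a; case: (a.1 =P v) => [->|_]; last by rewrite !andbF.
  by rewrite -in_setI vCP.
move=> [u u'] /= /andP[/orP[->//|/eqP->] _]; apply: x0.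
by move: vCP; rewrite mem_arcs inE => /andP[_ ->]; rewrite andbF.
Qed.

Lemma sum_flow_in s x C : flow P s x ->
  (\sum_(v in C :&: ~: P) s v = \sum_(a | a.2 \in C) x a)%N.
Proof.
case=> x0 xm; rewrite (bigID (fun a => a.2 \in ~: P)) /= addnC.
rewrite [X in (X + _)%N]big1 ?add0n; last first.
  move=> [u v] /= /andP[_]; rewrite inE negbK => vP.
  by apply: x0; rewrite mem_arcs vP andbF.
rewrite (partition_big (fun a => a.2) (fun v => v \in C :&: ~: P)) /=; last first.
  by move=> a; rewrite in_setI.
apply: eq_bigr => v vCP; rewrite -xm /margin (bigID (fun a => a.2 == v)) /=.
rewrite [X in (_ + X)%N]big1 ?addn0.
  apply: eq_bigl => a; case: (a.2 =P v) => [->|_]; last by rewrite !andbF.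
  by rewrite -in_setI vCP orbT.
move=> [u u'] /= /andP[/orP[/eqP->|->//] _]; apply: x0.
by move: vCP; rewrite mem_arcs !inE => /andP[_ /negbTE->].
Qed.

Lemma flow_arcs_closed s x C : flow P s x ->
  (forall a, a \in flow_arcs x -> (a.1 \in C) = (a.2 \in C)) ->
  (\sum_(v in C :&: P) s v = \sum_(v in C :&: ~: P) s v)%N.
Proof.
move=> fx clC; rewrite (sum_flow_out _ fx) (sum_flow_in _ fx).
rewrite big_mkcond [RHS]big_mkcond; apply: eq_bigr => a _.
have [x0|x_gt0] := posnP (x a); first by rewrite x0 !if_same.
by rewrite clC // inE.
Qed.

Lemma degE (T : {set V * V}) v :
  deg T v = margin (fun a => a \in T : nat) v.
Proof.
rewrite /deg /margin -sum1_card big_mkcond [RHS]big_mkcond.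
by apply: eq_bigr => a _; rewrite inE; case: (_ \in T) => //=; rewrite if_same.
Qed.

(** Seeing the degrees of T as the loads of its indicator flow makes the
    handshake identity [sum_deg] a case of [sum_flow_out] and [sum_flow_in]. *)
Lemma deg_flow (T : {set V * V}) : T \subset arcs ->
  flow P (deg T) (fun a => a \in T : nat).
Proof.
move=> /subsetP sT; split=> [a aP | v]; last by rewrite degE.
by rewrite (negbTE (contra (sT a) aP)).
Qed.

Lemma sum_deg (T : {set V * V}) (A : {set V}) : T \subset arcs ->
  A = P \/ A = ~: P -> (\sum_(v in A) deg T v = #|T|)%N.
Proof.
move=> /deg_flow fT AP.
have -> : (#|T| = \sum_a (a \in T))%N by rewrite -sum1_card big_mkcond.
case: AP => ->.
  have := sum_flow_out setT fT; rewrite setTI => ->.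
  by apply: eq_bigl => a; rewrite inE.
have := sum_flow_in setT fT; rewrite setTI => ->.
by apply: eq_bigl => a; rewrite inE.
Qed.

Lemma flow_le_deg s x v K : flow P s x -> (forall a, x a <= K)%N ->
  (s v <= deg (flow_arcs x) v * K)%N.
Proof.
case=> _ <- xK; rewrite degE /margin big_distrl /=; apply: leq_sum => a _.
by rewrite inE; case: (posnP (x a)) => [->|]; rewrite // mul1n.
Qed.

(** No proper nonempty set of nodes being balanced is what makes the support
    of every flow connected: a component of the support would be balanced.
    Connectedness of the support also lets every node be reached in the residual
    graph, so the potentials exist; on an arc of the support the residual graph
    has moves in both directions, so the potential inequality is an equality. *)
Lemma nondegenerate_transportation (R : realFieldType) (w : V * V -> R) s
    (r : V) :
  (forall a, 0 < w a) ->
  (\sum_(v in P) s v = \sum_(v in ~: P) s v)%N ->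
  (forall C, \sum_(v in C :&: P) s v = \sum_(v in C :&: ~: P) s v ->
     C = set0 \/ C = setT)%N ->
  exists (x : V * V -> nat) (y : V -> R),
    [/\ flow P s x, spanning_tree arcs (flow_arcs x), forall v, 0 < y v,
        forall a, a \in arcs -> y a.2 <= w a * y a.1 &
        forall a, a \in flow_arcs x -> w a * y a.1 = y a.2].
Proof.
move=> w_gt0 /flow_exists[x0 /(optimal_exists w)[x x_opt]] nondeg.
have [fx _ _] := x_opt.
have symT : connect_sym (adj (flow_arcs x)) by apply/sym_connect_sym/adj_sym.
have conn u v : connect (adj (flow_arcs x)) u v.
  have [|C0|CT] := nondeg [set v | connect (adj (flow_arcs x)) u v].
  - apply: (flow_arcs_closed fx) => a aT; rewrite !inE.
    apply: same_connect_r => //; apply: connect1.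
    by rewrite /adj -surjective_pairing aT.
  - by move/setP/(_ u): C0; rewrite !inE connect0.
  - by move/setP/(_ v): CT; rewrite !inE.
have res_conn v : connect (residual P x) r v.
  apply: connect_sub (conn r v) => {}u {}v /orP[|].
    by move=> /(subsetP (flow_arcs_sub fx)) uv; rewrite connect1 // /residual uv.
  by rewrite inE => vu; rewrite connect1 // /residual vu orbT.
have cyc_ge1 c : ucycle (residual P x) c -> c != [::] ->
    1 <= cycle_weight (residual_weight P w) c.
  by move=> cyc _; apply: optimal_cycle_weight_ge1 x_opt cyc.
have [y [y_gt0 y_le]] :=
  potential_of_cycle_weight_ge1 (residual_weight_gt0 P w_gt0) cyc_ge1 res_conn.
have y_arc a : a \in arcs -> y a.2 <= w a * y a.1.
  case: a => u v uv; have := y_le u v; rewrite {1}/residual uv => /(_ isT).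
  by move: uv; rewrite mem_arcs /residual_weight mulrC => /andP[->].
exists x, y; split=> //.
  split=> //; first exact: flow_arcs_sub fx.
  exact: optimal_support_acyclic x_opt.
case=> u v uvT; have uv := subsetP (flow_arcs_sub fx) _ uvT.
apply/le_anti/andP; split; last exact: y_arc.
have := y_le v u; rewrite /residual; move: uvT; rewrite inE => ->.
rewrite orbT => /(_ isT); move: uv; rewrite mem_arcs /residual_weight.
by case/andP=> _ /negbTE->; rewrite ler_pdivlMr // mulrC.
Qed.

End Transportation.

(** * Trees with prescribed degrees *)

(** The loads are those described at the top.  On a balanced set C the number
    of nodes of C in A is a multiple of p, so C contains none or all of A;
    comparing the remaining loads, C is empty or everything. *)
Lemma tree_solution_with_degrees (R : realFieldType) (V : finType)
    (P A : {set V}) (w : V * V -> R) (c : V -> nat) :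
  (forall a, 0 < w a) -> A != set0 -> A = P \/ A = ~: P ->
  (forall v, v \in A -> 0 < c v)%N -> (\sum_(v in A) c v).+1 = #|V| ->
  exists (T : {set V * V}) (y : V -> R),
    [/\ spanning_tree (bip_digraph P (~: P)) T, forall v, 0 < y v,
        forall a, a \in bip_digraph P (~: P) -> y a.2 <= w a * y a.1,
        forall a, a \in T -> w a * y a.1 = y a.2 &
        forall v, v \in A -> deg T v = c v].
Proof.
move=> w_gt0 /set0Pn[r rA] AP c_gt0 sum_c.
pose p := #|A|.
have p_gt0 : (0 < p)%N by apply/card_gt0P; exists r.
pose s v := (if v \in A then p * (c v).-1 + 1 else p)%N.
have sumA (C : {set V}) :
    (\sum_(v in C :&: A) s v = p * (\sum_(v in C :&: A) (c v).-1) + #|C :&: A|)%N.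
  rewrite -sum1_card big_distrr -big_split /=; apply: eq_bigr => v.
  by rewrite inE /s => /andP[_ ->].
have sumB (C : {set V}) : (\sum_(v in C :&: ~: A) s v = #|C :&: ~: A| * p)%N.
  rewrite -sum_nat_const; apply: eq_bigr => v.
  by rewrite !inE /s => /andP[_ /negbTE->].
have balA : (\sum_(v in A) s v = \sum_(v in ~: A) s v)%N.
  have := sumA setT; have := sumB setT; rewrite !setTI => -> ->.
  have sum_pred : (\sum_(v in A) (c v).-1 + p = \sum_(v in A) c v)%N.
    rewrite /p -sum1_card -big_split /=; apply: eq_bigr => v vA.
    by rewrite addn1 prednK ?c_gt0.
  have := cardsC A; rewrite -sum_c -sum_pred -/p; nia.
have nondegA (C : {set V}) :
    (\sum_(v in C :&: A) s v = \sum_(v in C :&: ~: A) s v)%N -> C = set0 \/ C = setT.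
  move=> balC; have := balC; rewrite sumA sumB => eqC.
  have le_p : (#|C :&: A| <= p)%N by apply/subset_leq_card/subsetIr.
  have p_dvd : (p %| #|C :&: A|)%N.
    have p_dvd_sum := dvdn_mulr (\sum_(v in C :&: A) (c v).-1)%N (dvdnn p).
    by rewrite -(dvdn_addr _ p_dvd_sum) eqC dvdn_mull.
  have [CA0|CA_gt0] := posnP #|C :&: A|.
    left; have /eqP := CA0; rewrite cards_eq0 => /eqP CA0'.
    move: eqC; rewrite CA0' big_set0 cards0 muln0 => /esym/eqP.
    rewrite muln_eq0 [p == _]eqn0Ngt p_gt0 orbF cards_eq0 => /eqP CB0.
    by rewrite -(setID C A) CA0' setDE CB0 setU0.
  have CA : C :&: A = A.
    by apply/eqP; rewrite eqEcard subsetIr /= dvdn_leq.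
  have CB : C :&: ~: A = ~: A.
    apply/eqP; rewrite eqEcard subsetIr /= -(leq_pmul2r p_gt0).
    by rewrite -sumB -balC CA balA; have := sumB setT; rewrite setTI => ->.
  by right; rewrite -(setID C A) setDE CA CB setUCr.
have [bal nondeg] : (\sum_(v in P) s v = \sum_(v in ~: P) s v)%N /\
    (forall C : {set V}, \sum_(v in C :&: P) s v = \sum_(v in C :&: ~: P) s v ->
       C = set0 \/ C = setT)%N.
  case: AP balA nondegA => ->; first by [].
  by rewrite setCK => bal nd; split=> // C /esym; apply: nd.
have [x [y [fx treeT y_gt0 y_arc y_T]]] :=
  nondegenerate_transportation r w_gt0 bal nondeg.
exists (flow_arcs x), y; split=> //.
have [sT _ acT] := treeT.
(* An arc has an end outside A, whose load is p. *)
have xp a : (x a <= p)%N.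
  have [aP|/(proj1 fx)->//] := boolP (a \in bip_digraph P (~: P)).
  have sP v : v \notin A -> (a.1 == v) || (a.2 == v) -> (x a <= p)%N.
    by move=> vA /(flow_le fx); rewrite /s (negbTE vA).
  case: a aP sP => u v; rewrite mem_arcs /= => /andP[uP vP] sP.
  case: AP => AP; [apply: (sP v) | apply: (sP u)];
    by rewrite ?AP ?inE ?uP ?eqxx ?orbT.
(* p (c v - 1) + 1 units leave v on arcs carrying at most p units each. *)
have c_le v : v \in A -> (c v <= deg (flow_arcs x) v)%N.
  move=> vA; have := flow_le_deg v fx xp; rewrite /s vA.
  have := c_gt0 v vA; nia.
have le_sum : (\sum_(v in A) deg (flow_arcs x) v <= \sum_(v in A) c v)%N.
  rewrite (sum_deg sT AP) -ltnS sum_c; apply: dacyclic_card acT.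
  by rewrite -sum_c.
have [_] := leqif_sum (fun v vA => leqif_eq (c_le v vA)).
have -> : (\sum_(v in A) c v == \sum_(v in A) deg (flow_arcs x) v)%N.
  by rewrite eqn_leq le_sum andbT leq_sum.
by move=> /esym/forall_inP eq_c v /eq_c/eqP->.
Qed.

Lemma feasible_tree_solution_with_degrees (R : realType) (d : nat)
    (Pi : 'M[R]_d) (P N A : {set 'I_d}) (c : 'I_d -> nat) :
  (0 < d)%N -> (forall i j, 0 < Pi i j) -> bipartition P N ->
  A = P \/ A = N -> configuration A c ->
  exists (y : 'rV[R]_d) (T : {set 'I_d * 'I_d}),
    feasible_tree_solution Pi P N T y /\ (forall i, i \in A -> deg T i = c i).
Proof.
move=> d_gt0 Pi_gt0 [P0 N0 dPN PN] AP [c_gt0 sum_c].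
have NE : N = ~: P.
  apply/setP=> i; rewrite inE; have := in_setT i; rewrite -PN inE.
  have [iP _|_ /= ->//] := boolP (i \in P).
  by rewrite (disjointFr dPN).
have A0 : A != set0 by case: AP => ->.
have AP' : A = P \/ A = ~: P by rewrite -NE.
have sum_c' : (\sum_(v in A) c v).+1 = #|{: 'I_d}|.
  by rewrite sum_c card_ord subn1 prednK.
have [T [y [treeT y_gt0 y_arc y_T degT]]] :=
  tree_solution_with_degrees (w := fun a => Pi a.1 a.2)
    (fun a => Pi_gt0 a.1 a.2) A0 AP' c_gt0 sum_c'.
exists (\row_i y i), T; split=> //; rewrite NE; split.
  by move=> i j ij; rewrite !mxE; split=> //; apply: (y_arc (i, j)).
by split=> // i j ij; rewrite !mxE; split=> //; apply: (y_T (i, j)).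
Qed.

Theorem theorem11 (R : realType) (d : nat) (hd : (2 <= d)%N) (Pi : 'M[R]_d)
  (Pi_diag : forall i : 'I_d, Pi i i = 1)
  (Pi_gt0 : forall i j : 'I_d, 0 < Pi i j)
  (Pi_triangle : forall i j k : 'I_d, Pi i j <= Pi i k * Pi k j)
  (Pi_strict : exists i j k : 'I_d, Pi i j < Pi i k * Pi k j) :
  (forall P N : {set 'I_d}, bipartition P N ->
     forall c : 'I_d -> nat, configuration P c ->
       exists (y : 'rV[R]_d) (T : {set 'I_d * 'I_d}),
         feasible_tree_solution Pi P N T y /\
         (forall i, i \in P -> deg T i = c i)) /\
  (forall P N : {set 'I_d}, bipartition P N ->
     forall b : 'I_d -> nat, configuration N b ->
       exists (y : 'rV[R]_d) (T : {set 'I_d * 'I_d}),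
         feasible_tree_solution Pi P N T y /\
         (forall j, j \in N -> deg T j = b j)).
Proof.
have d_gt0 : (0 < d)%N by apply: ltnW.
split=> P N PN c cfg; apply: feasible_tree_solution_with_degrees cfg => //.
  by left.
by right.
Qed.
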